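(* Let $H$ be a finite dimensional hereditary algebra over a field, with $n$ isomorphism classes of simple modules, and let $\mathcal E=(E_1,\dots,E_n)$ be a complete exceptional sequence in $\operatorname{mod}H$. Then the Hom-Ext quiver $\mathcal Q_{\mathcal E}$ of $\mathcal E$ is acyclic, i.e. has no oriented cycles.
   Context: $\operatorname{mod}H$ is the category of finitely generated $H$-modules. An indecomposable $H$-module $E$ is exceptional if $\operatorname{Ext}^1(E,E)=0$. A sequence $(E_1,\dots,E_r)$ of exceptional modules is an exceptional sequence if $\operatorname{Hom}(E_j,E_i)=0=\operatorname{Ext}^1(E_j,E_i)$ for $j>i$; it is complete if $r=n$. The Hom-Ext quiver $\mathcal Q_{\mathcal E}$ of $\mathcal E=(E_1,\dots,E_r)$ has vertex set $\{E_1,\dots,E_r\}$, and for $i\ne j$ there is an arrow $E_i\to E_j$ if $\operatorname{Hom}(E_i,E_j)\ne0$ or $\operatorname{Ext}^1(E_j,E_i)\ne 0$. *)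

(* Defs.v *)
From HB Require Import structures.
From mathcomp Require Import all_boot all_order all_algebra all_field.
From Stdlib Require Import Relation_Operators.

Set Implicit Arguments.
Unset Strict Implicit.
Unset Printing Implicit Defensive.

Import GRing.Theory.
Local Open Scope ring_scope.

(* Modules over [R] are left modules.  Right modules over a finite dimensional
   hereditary algebra are left modules over its opposite algebra, which is again
   finite dimensional hereditary. *)

Definition surj (A B : Type) (f : A -> B) : Prop := forall b, exists a, f a = b.

Definition zero_module (R : nzRingType) (M : lmodType R) : Prop :=
  forall x : M, x = 0.

Definition iso_module (R : nzRingType) (M N : lmodType R) : Prop :=
  exists f : {linear M -> N}, bijective f.

Definition finitely_generated (R : nzRingType) (M : lmodType R) : Prop :=
  exists (m : nat) (g : 'I_m -> M),
    forall x : M, exists c : 'I_m -> R, x = \sum_(i < m) c i *: g i.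

Definition simple_module (R : nzRingType) (M : lmodType R) : Prop :=
  ~ zero_module M /\
  forall S : {pred M}, GRing.submod_closed S ->
    (forall x : M, x \in S -> x = 0) \/ (forall x : M, x \in S).

Definition indecomposable (R : nzRingType) (M : lmodType R) : Prop :=
  ~ zero_module M /\
  forall A B : lmodType R,
    iso_module M (A * B)%type -> zero_module A \/ zero_module B.

Definition projective (R : nzRingType) (P : lmodType R) : Prop :=
  forall (M N : lmodType R) (p : {linear M -> N}) (f : {linear P -> N}),
    surj p -> exists h : {linear P -> M}, forall x, p (h x) = f x.

(* Submodules are given as images of injective linear maps.  This is left
   heredity, which for finite dimensional algebras is left-right symmetric. *)
Definition hereditary (R : nzRingType) : Prop :=
  forall (P M : lmodType R) (i : {linear M -> P}),
    injective i -> projective P -> projective M.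

Definition simple_classes (R : nzRingType) (n : nat) : Prop :=
  exists S : 'I_n -> lmodType R,
    [/\ forall i, simple_module (S i),
        forall i j, iso_module (S i) (S j) -> i = j
      & forall M : lmodType R, simple_module M -> exists i, iso_module M (S i)].

Definition hom_zero (R : nzRingType) (M N : lmodType R) : Prop :=
  forall (f : {linear M -> N}) (x : M), f x = 0.

(* Yoneda's Ext^1(M, N): short exact sequences 0 -> N -> X -> M -> 0 up to
   equivalence; the zero of this group is the class of 0 -> N -> N * M -> M -> 0. *)
Record extension (R : nzRingType) (M N : lmodType R) := Extension {
  ext_mid : lmodType R;
  ext_inj : {linear N -> ext_mid};
  ext_proj : {linear ext_mid -> M};
  ext_injP : injective ext_inj;
  ext_projP : surj ext_proj;
  ext_exact : forall x, ext_proj x = 0 <-> exists y, ext_inj y = x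
}.

(* A comparison map [h] is automatically an isomorphism, by the five lemma. *)
Definition ext_equiv (R : nzRingType) (M N : lmodType R)
    (X Y : extension M N) : Prop :=
  exists h : {linear ext_mid X -> ext_mid Y},
    (forall y, h (ext_inj X y) = ext_inj Y y) /\
    (forall x, ext_proj Y (h x) = ext_proj X x).

Section SplitExtension.
Variables (R : nzRingType) (M N : lmodType R).

Definition inl_lin (y : N) : (N * M)%type := (y, 0).

Fact inl_lin_is_linear : linear inl_lin.
Proof. by move=> a u v; congr pair; rewrite /= scaler0 addr0. Qed.

HB.instance Definition _ :=
  GRing.isLinear.Build R N (N * M)%type _ inl_lin inl_lin_is_linear.

Fact inl_lin_inj : injective inl_lin.
Proof. by move=> u v []. Qed.

Fact snd_surj : surj (snd : N * M -> M).
Proof. by move=> m; exists (0, m). Qed.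

Fact split_exact (x : (N * M)%type) : x.2 = 0 <-> exists y, inl_lin y = x.
Proof. by case: x => u v /=; split=> [->|[y [_ <-]]] //; exists u. Qed.

Definition split_extension : extension M N :=
  @Extension R M N (N * M)%type inl_lin snd inl_lin_inj snd_surj split_exact.

End SplitExtension.

Definition ext1_zero (R : nzRingType) (M N : lmodType R) : Prop :=
  forall X : extension M N, ext_equiv X (split_extension M N).

Definition exceptional (R : nzRingType) (M : lmodType R) : Prop :=
  [/\ finitely_generated M, indecomposable M & ext1_zero M M].

(* Complete means that [r] is the number of isomorphism classes of simple
   modules, i.e. [simple_classes R r]. *)
Definition exceptional_sequence (R : nzRingType) (r : nat)
    (E : 'I_r -> lmodType R) : Prop :=
  (forall i, exceptional (E i)) /\
  (forall i j : 'I_r, (i < j)%N ->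
     hom_zero (E j) (E i) /\ ext1_zero (E j) (E i)).

(* The vertex [E i] is represented by its index [i]. *)
Definition hom_ext_arrow (R : nzRingType) (r : nat) (E : 'I_r -> lmodType R)
    (i j : 'I_r) : Prop :=
  i <> j /\ (~ hom_zero (E i) (E j) \/ ~ ext1_zero (E j) (E i)).

(* An oriented cycle is a directed path of positive length from a vertex to
   itself. *)
Definition acyclic (V : Type) (arrow : V -> V -> Prop) : Prop :=
  forall v : V, ~ clos_trans V arrow v v.

(* Main.v *)
From HB Require Import structures.
Require Import Defs.
From mathcomp Require Import all_boot all_order all_algebra all_field.
From Stdlib Require Import Classical ClassicalEpsilon.
From Stdlib Require Import Relation_Operators Operators_Properties.

(* An arrow i -> j with Hom(E_i, E_j) <> 0 has i < j and, by the Happel-Ringel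
   lemma, is witnessed by a mono M or an epi P; an arrow with
   Ext^1(E_j, E_i) <> 0, say X, has i > j.  Since H is hereditary, Ext^1 is right
   exact, so an epi followed by X, or X followed by a mono, is again X; an epi
   followed by a mono is a nonzero map, hence M or P; and monos and epis compose.
   Thus every path reduces to the form M? X* P?, and rotating a closed path of
   this form brings P next to M, which leaves only decreasing arrows or only
   increasing ones. *)

Set Implicit Arguments.
Unset Strict Implicit.
Unset Printing Implicit Defensive.

Import GRing.Theory.
Local Open Scope ring_scope.

(** * Submodules and quotient modules as objects of [lmodType R] *)

Section Submodule.
Variables (R : nzRingType) (M : lmodType R) (S : pred M).

Definition submodule of GRing.submod_closed S := {x : M | S x}.

Variable cS : GRing.submod_closed S.
HB.instance Definition _ := SubChoice.on (submodule cS).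
HB.instance Definition _ := GRing.SubChoice_isSubLmodule.Build R M S (submodule cS)
   (GRing.submod_closed_semi cS).
End Submodule.

Section QuotientModule.
Variables (R : nzRingType) (M : lmodType R) (S : zmodClosed M).
Local Open Scope quotient_scope.

(** Carrying the stability proof [cS] in the type lets the scaling structure below be attached to
    it. *)
Definition quotient_module of (forall a : R, {in S, forall x, a *: x \in S}) :=
  Quotient.quot S.

Variable cS : forall a : R, {in S, forall x, a *: x \in S}.
Local Notation Q := (quotient_module cS).
HB.instance Definition _ := GRing.Zmodule.on Q.
Local Notation pi := (\pi_(Quotient.quot S) : M -> Q).

Definition quotient_scale (a : R) (x : Q) : Q := pi (a *: repr x).

Lemma quotient_piP (x y : M) : pi x = pi y <-> x - y \in S.
Proof. by rewrite Quotient.idealrBE; split=> [->|/eqP]. Qed.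

Lemma quotient_piD : {morph pi : x y / x + y}.
Proof. by move=> x y /=; rewrite piE. Qed.

Lemma quotient_piZ a x : quotient_scale a (pi x) = pi (a *: x).
Proof.
apply/quotient_piP; rewrite -scalerBr; apply: cS.
by rewrite Quotient.idealrBE reprK.
Qed.

Lemma quotient_pi_surj (x : Q) : exists y, x = pi y.
Proof. by exists (repr x); rewrite reprK. Qed.

Lemma quotient_scaleA a b x :
  quotient_scale a (quotient_scale b x) = quotient_scale (a * b) x.
Proof. by have [y ->] := quotient_pi_surj x; rewrite !quotient_piZ scalerA. Qed.

Lemma quotient_scale1 : left_id 1 quotient_scale.
Proof.
by move=> x; have [y ->] := quotient_pi_surj x; rewrite quotient_piZ scale1r.
Qed.

Lemma quotient_scaleDr : right_distributive quotient_scale +%R.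
Proof.
move=> a x y; have [[u ->] [v ->]] := (quotient_pi_surj x, quotient_pi_surj y).
by rewrite -quotient_piD !quotient_piZ scalerDr quotient_piD.
Qed.

Lemma quotient_scaleDl x : {morph quotient_scale^~ x : a b / a + b}.
Proof.
move=> a b; have [y ->] := quotient_pi_surj x.
by rewrite !quotient_piZ scalerDl quotient_piD.
Qed.

HB.instance Definition _ := GRing.Zmodule_isLmodule.Build R Q
  quotient_scaleA quotient_scale1 quotient_scaleDr quotient_scaleDl.

Lemma quotient_pi_linear : linear pi.
Proof. by move=> a u v; rewrite quotient_piD -quotient_piZ. Qed.

End QuotientModule.

(** * Kernels, images and factorization of linear maps *)

Section LinearMaps.
Variable R : nzRingType.
Implicit Types M N P X : lmodType R.

Lemma linear_ex M N (f : M -> N) : linear f -> exists g : {linear M -> N}, g =1 f.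
Proof.
move=> lf.
by exists (HB.pack_for {linear M -> N} f (GRing.isLinear.Build R M N _ f lf)).
Qed.

(** [Prop]-valued, since membership in an image is an existential statement; [submod_prop_pred]
    makes it boolean by excluded middle. *)
Definition submod_prop M (S : M -> Prop) : Prop :=
  S 0 /\ forall (a : R) u v, S u -> S v -> S (a *: u + v).

Lemma submod_prop_pred M (S : M -> Prop) : submod_prop S ->
  exists2 T : pred M, GRing.submod_closed T & forall x, T x <-> S x.
Proof.
move=> [S0 SD].
pose T x := if excluded_middle_informative (S x) then true else false.
have TP x : T x <-> S x by rewrite /T; case: excluded_middle_informative.
exists T => //; split; first exact/TP.
by move=> a u v /TP Su /TP Sv; apply/TP/SD.
Qed.

Lemma submodule_ex M (S : M -> Prop) : submod_prop S ->
  exists (N : lmodType R) (i : {linear N -> M}),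
    injective i /\ forall x, S x <-> exists y, i y = x.
Proof.
move=> /submod_prop_pred[T cT TP].
have [|i iE] := @linear_ex (submodule cT) M val.
  by move=> a u v; rewrite linearP.
exists (submodule cT), i; split=> [x y|x].
  by rewrite !iE; apply: val_inj.
split=> [/TP Tx|[y <-]]; first by exists (Sub x Tx); rewrite iE SubK.
by rewrite iE; apply/TP/valP.
Qed.

Lemma quotient_ex M (S : M -> Prop) : submod_prop S ->
  exists (Q : lmodType R) (p : {linear M -> Q}),
    surj p /\ forall x, p x = 0 <-> S x.
Proof.
move=> /submod_prop_pred[T cT TP].
pose T' : zmodClosed M := HB.pack_for (zmodClosed M) T
  (GRing.isZmodClosed.Build M T (GRing.submod_closedB cT)).
have sT (a : R) : {in T', forall x, a *: x \in T'}.
  by move=> x Tx; rewrite -[_ *: _]addr0; apply: cT.2 => //; apply: cT.1.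
have [p pE] := linear_ex (quotient_pi_linear sT).
exists (quotient_module sT), p; split=> [x|x].
  by exists (repr x)%qT; rewrite pE reprK.
rewrite -(linear0 p) !pE (quotient_piP sT) subr0.
exact: TP.
Qed.

Lemma ker_submod M N (f : {linear M -> N}) : submod_prop (fun x => f x = 0).
Proof.
by split=> [|a u v fu fv]; rewrite ?linear0 // linearP fu fv scaler0 addr0.
Qed.

Lemma im_submod M N (f : {linear M -> N}) :
  submod_prop (fun x => exists y, f y = x).
Proof.
split=> [|a _ _ [u <-] [v <-]]; first by exists 0; rewrite linear0.
by exists (a *: u + v); rewrite linearP.
Qed.

Lemma preim_submod M N (f : {linear M -> N}) (S : N -> Prop) :
  submod_prop S -> submod_prop (fun x => S (f x)).
Proof.
move=> [S0 SD]; split=> [|a u v fu fv]; first by rewrite linear0.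
by rewrite linearP; apply: SD.
Qed.

(** Preimages under [i] are unique, so their pointwise choice is automatically linear. *)
Lemma factor_inj M N X (i : {linear N -> X}) (f : {linear M -> X}) :
  injective i -> (forall x, exists y, i y = f x) ->
  exists g : {linear M -> N}, forall x, i (g x) = f x.
Proof.
move=> i_inj fi.
have fi' x : exists y, i y == f x by have [y /eqP] := fi x; exists y.
pose g x := xchoose (fi' x).
have gP x : i (g x) = f x by apply/eqP/(xchooseP (fi' x)).
have [|h hE] := @linear_ex M N g.
  by move=> a u v; apply: i_inj; rewrite linearP !gP linearP.
by exists h => x; rewrite hE.
Qed.

(** The chosen section [s] of [p] need not be linear, but [f \o s] is: two preimages of a point
    differ by an element of the kernel of [p], which [f] kills. *)
Lemma factor_surj M P X (p : {linear P -> M}) (f : {linear P -> X}) :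
  surj p -> (forall x, p x = 0 -> f x = 0) ->
  exists g : {linear M -> X}, forall x, g (p x) = f x.
Proof.
move=> p_surj kpf.
have p_surj' y : exists x, p x == y by have [x /eqP] := p_surj y; exists x.
pose s y := xchoose (p_surj' y).
have sP y : p (s y) = y by apply/eqP/(xchooseP (p_surj' y)).
have fE x y : p x = p y -> f x = f y.
  by move=> e; apply/eqP; rewrite -subr_eq0 -linearB kpf // linearB e subrr.
have [|h hE] := @linear_ex M X (f \o s).
  by move=> a u v /=; rewrite -linearP; apply: fE; rewrite linearP !sP.
by exists h => x; rewrite hE /=; apply: fE; rewrite sP.
Qed.

End LinearMaps.

(** * Projective modules and extension of maps along a short exact sequence *)

Section Projective.
Variable R : nzRingType.
Implicit Types M N P X A B C : lmodType R.

Lemma row_linear_ex m M (g : 'I_m -> M) :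
  exists p : {linear 'rV[R]_m -> M}, forall r, p r = \sum_(i < m) r 0 i *: g i.
Proof.
apply: linear_ex => a u v; rewrite scaler_sumr -big_split.
by apply: eq_bigr => i _; rewrite /= !mxE scalerDl scalerA.
Qed.

Lemma row_projective m : projective 'rV[R]_m.
Proof.
move=> M N p f p_surj.
have p_surj' y : exists x, p x == y by have [x /eqP] := p_surj y; exists x.
pose g i := xchoose (p_surj' (f (delta_mx 0 i))).
have gP i : p (g i) = f (delta_mx 0 i) by apply/eqP/(xchooseP (p_surj' _)).
have [h hE] := row_linear_ex g; exists h => r.
rewrite hE linear_sum [in RHS](row_sum_delta r) linear_sum.
by apply: eq_bigr => i _; rewrite !linearZ /= gP.
Qed.

Lemma finitely_generated_cover M : finitely_generated M ->
  exists2 P : lmodType R, projective P & exists p : {linear P -> M}, surj p.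
Proof.
move=> [m [g gP]]; exists 'rV[R]_m; first exact: row_projective.
have [p pE] := row_linear_ex g; exists p => x.
have [c ->] := gP x; exists (\row_i c i); rewrite pE.
by apply: eq_bigr => i _; rewrite mxE.
Qed.

(* Push the extension out along [t] and retract. *)
Lemma ext1_zero_extend M N A (X : extension M N) (t : {linear N -> A}) :
  ext1_zero M A ->
  exists s : {linear ext_mid X -> A}, forall y, s (ext_inj X y) = t y.
Proof.
case: X => X i p i_inj p_surj iP /= extMA.
(* The pushout [Z] is [A * X] modulo the image of [N] under [t] and [- i]; the maps [j] and [r] make
   it an extension of [M] by [A]. *)
pose S (z : (A * X)%type) := exists y, z = (t y, - i y).
have subS : submod_prop S.
  split=> [|a _ _ [u ->] [v ->]]; first by exists 0; rewrite !linear0.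
  by exists (a *: u + v); rewrite !linearP.
have [Z [q [q_surj qP]]] := quotient_ex subS.
have [j jE] : exists j : {linear A -> Z}, forall a, j a = q (a, 0).
  apply: linear_ex => a u v; rewrite -linearP; congr (q _).
  by congr pair; rewrite /= scaler0 addr0.
have [|r rE] := @factor_surj _ _ _ _ q (p \o snd) q_surj.
  move=> [a x] /qP[y [_ ->]] /=; rewrite linearN; apply/eqP; rewrite oppr_eq0.
  by apply/eqP/iP; exists y.
have j_inj : injective j.
  move=> a b /eqP; rewrite -subr_eq0 -linearB jE => /eqP/qP[y [e1 e2]].
  have y0 : y = 0 by apply: i_inj; rewrite linear0; apply/eqP; rewrite -oppr_eq0 -e2.
  by apply/eqP; rewrite -subr_eq0 e1 y0 linear0.
have r_surj : surj r.
  by move=> m; have [x <-] := p_surj m; exists (q (0, x)); rewrite rE.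
have r_exact z : r z = 0 <-> exists a, j a = z.
  split=> [|[a <-]]; last by rewrite jE rE /= linear0.
  have [[a x] <-] := q_surj z; rewrite rE /= => /iP[y <-].
  exists (a + t y); rewrite jE; apply/eqP; rewrite -subr_eq0 -linearB.
  apply/eqP/qP; exists y; congr pair; first by rewrite /= addrC addKr.
  by rewrite /= sub0r.
have [h [hj _]] := extMA (Extension j_inj r_surj r_exact).
have [s sE] : exists s : {linear X -> A}, forall x, s x = (h (q (0, x))).1.
  apply: linear_ex => a u v.
  have -> : (0, a *: u + v) = a *: (0, u) + (0, v) :> A * X.
    by congr pair; rewrite /= scaler0 addr0.
  by rewrite !linearP.
exists s => y; rewrite sE.
have -> : q (0, i y) = j (t y).
  apply/eqP; rewrite jE -subr_eq0 -linearB; apply/eqP/qP.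
  by exists (- y); rewrite !linearN opprK; congr pair; rewrite /= ?sub0r ?subr0.
by rewrite hj.
Qed.

(** The map [1 - s p] lands in the kernel of [p], hence factors through [i] as a retraction [r]; the
    pair of [r] and [p] is the comparison map. *)
Lemma section_split M N (X : extension M N) (s : {linear M -> ext_mid X}) :
  (forall m, ext_proj X (s m) = m) -> ext_equiv X (split_extension M N).
Proof.
case: X s => X i p i_inj p_surj iP /= s sP.
have [x|r rE] := @factor_inj _ _ _ _ i (idfun \- (s \o p)) i_inj.
  by apply/iP; rewrite linearB /= sP subrr.
have [h hE] : exists h : {linear X -> (N * M)%type}, forall x, h x = (r x, p x).
  by apply: linear_ex => a u v; rewrite !linearP.
have pi0 y : p (i y) = 0 by apply/iP; exists y.
exists h; split=> [y|x]; rewrite hE //= pi0; congr pair.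
by apply: i_inj; rewrite rE /= pi0 linear0 subr0.
Qed.

(** * Right exactness of Ext^1 over a hereditary ring, and splitting of idempotents *)

Hypothesis hH : hereditary R.

(** The kernel [K] of a projective cover map [e : P -> M] is projective by heredity. The map
    [q' : K -> B] determined by the extension therefore lifts along [p] to [A], and the lift extends
    to [t'] on [P]. Subtracting [i p t'] from [q] kills [K] and leaves a section. *)
Lemma ext1_zero_epi M A B (p : {linear A -> B}) :
  finitely_generated M -> surj p -> ext1_zero M A -> ext1_zero M B.
Proof.
move=> /finitely_generated_cover[P Pproj [e e_surj]] p_surj extMA.
case=> W i r i_inj r_surj iP.
have [q qP] := Pproj _ _ r e r_surj.
have [K [c [c_inj cP]]] := submodule_ex (ker_submod e).
have [x|q' q'P] := @factor_inj _ _ _ _ i (q \o c) i_inj.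
  by apply/iP; rewrite /= qP; apply/cP; exists x.
have [t tP] := hH c_inj Pproj q' p_surj.
have [t' t'P] := ext1_zero_extend (Extension c_inj e_surj cP) t extMA.
rewrite /= in t' t'P.
have [x /cP[y <-]|s sP] :=
    @factor_surj _ _ _ _ e (q \- (i \o p \o t')) e_surj.
  by rewrite /= t'P tP q'P subrr.
apply: (section_split (X := Extension i_inj r_surj iP) (s := s)) => /= m.
have [x <-] := e_surj m.
by rewrite sP linearB /= qP (proj2 (iP _)) ?subr0 //; exists (p (t' x)).
Qed.

(** Heredity makes the preimage [Q] of [B] in [P] projective, so [f : Q -> B] lifts to [q : Q -> W].
    The kernels of [f] and of [e : P -> A] agree, so the map [t] that [q] induces from this kernel
    to [N] extends to all of [P]; subtracting its restriction to [Q] makes [q] descend to a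
    section. *)
Lemma ext1_zero_mono A B N (i : {linear B -> A}) :
  finitely_generated A -> injective i -> ext1_zero A N -> ext1_zero B N.
Proof.
move=> /finitely_generated_cover[P Pproj [e e_surj]] i_inj extAN.
case=> W j r j_inj r_surj jP.
have [Q [d [d_inj dP]]] := submodule_ex (preim_submod e (im_submod i)).
have [x|f fP] := @factor_inj _ _ _ _ i (e \o d) i_inj.
  by apply/dP; exists x.
have f_surj : surj f.
  move=> b; have [x ex] := e_surj (i b).
  have [|y yx] := (dP x).1; first by exists b.
  by exists y; apply: i_inj; rewrite fP /= yx.
have [q qP] := hH d_inj Pproj f r_surj.
have [K [c [c_inj cP]]] := submodule_ex (ker_submod f).
have fc x : f (c x) = 0 by apply/cP; exists x.
have [x|t tP] := @factor_inj _ _ _ _ j (q \o c) j_inj.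
  by apply/jP; rewrite /= qP.
have dc_inj : injective (d \o c) by apply: inj_comp.
have dcP x : e x = 0 <-> exists y, (d \o c) y = x.
  split=> [ex|[y <-]]; last by rewrite /= -[e _]fP fc linear0.
  have [|y yx] := (dP x).1; first by exists 0; rewrite linear0.
  have [|z zy] := (cP y).1; first by apply: i_inj; rewrite fP /= yx ex linear0.
  by exists z; rewrite /= zy.
have [t' t'P] := ext1_zero_extend (Extension dc_inj e_surj dcP) t extAN.
rewrite /= in t' t'P.
have [x /cP[y <-]|s sP] :=
    @factor_surj _ _ _ _ f (q \- (j \o t' \o d)) f_surj.
  by rewrite /= t'P tP subrr.
apply: (section_split (X := Extension j_inj r_surj jP) (s := s)) => /= m.
have [x <-] := f_surj m.
by rewrite sP linearB /= qP (proj2 (jP _)) ?subr0 //; exists (t' (d x)).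
Qed.

(** [M] is the direct sum of the image and the kernel of [e], so one of the two vanishes. *)
Lemma indecomposable_idempotent M (e : {linear M -> M}) :
  indecomposable M -> (forall x, e (e x) = e x) ->
  (forall x, e x = 0) \/ (forall x, e x = x).
Proof.
move=> [_ indM] ee.
have [A [i [i_inj iP]]] := submodule_ex (im_submod e).
have [B [j [j_inj jP]]] := submodule_ex (ker_submod e).
have [x|f fP] := @factor_inj _ _ _ _ i e i_inj; first by apply/iP; exists x.
have [x|g gP] := @factor_inj _ _ _ _ j (idfun \- e) j_inj.
  by apply/jP; rewrite linearB /= ee subrr.
have ei a : e (i a) = i a.
  by have [x <-] : exists y, e y = i a by [apply/iP; exists a]; rewrite ee.
have ej b : e (j b) = 0 by apply/jP; exists b.
have [h hE] : exists h : {linear M -> (A * B)%type}, forall x, h x = (f x, g x).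
  by apply: linear_ex => a u v; rewrite !linearP.
have [|A0|B0] := indM A B.
- exists h; exists (fun z => i z.1 + j z.2) => [x|[a b]] /=; rewrite hE /=.
    by rewrite fP gP /= addrC subrK.
  congr pair.
    by apply: i_inj; rewrite fP linearD ei ej addr0.
  by apply: j_inj; rewrite gP /= linearD ei ej addr0 addrAC subrr add0r.
- by left=> x; rewrite -fP (A0 (f x)) linear0.
right=> x; apply/esym/eqP; rewrite -subr_eq0.
by rewrite -[x - e x]gP (B0 (g x)) linear0.
Qed.

End Projective.

(** * Fitting's lemma over a finite dimensional algebra *)

Section Fitting.
Variables (k : fieldType) (H : falgType k).
Implicit Types X Y : lmodType H.

(** The products of a [k]-basis of [H] with the generators over [H] span [X]; scalars of [k] act
    through [%:A]. *)
Lemma finitely_generated_over_field X : finitely_generated X ->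
  exists (N : nat) (b : 'I_N -> X), forall x, exists r : 'rV[k]_N,
    x = \sum_j (r 0 j)%:A *: b j.
Proof.
move=> [m [g gP]]; pose e := vbasis {:H}.
pose T : finType := ('I_m * 'I_(\dim {:H}))%type.
pose b (ij : T) := e`_ij.2 *: g ij.1.
exists #|T|, (fun j => b (enum_val j)) => x.
have [c ->] := gP x.
pose r (ij : T) := coord e ij.2 (c ij.1).
exists (\row_j r (enum_val j)).
transitivity (\sum_ij (r ij)%:A *: b ij).
  rewrite -(pair_bigA _ (fun i l => (coord e l (c i))%:A *: (e`_l *: g i))) /=.
  apply: eq_bigr => i _; rewrite [in LHS](coord_vbasis (memvf (c i))) scaler_suml.
  by apply: eq_bigr => l _; rewrite scalerA mulr_algl.
rewrite (reindex (@enum_val T T)) /=; last exact/onW_bij/enum_val_bij.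
by apply: eq_bigr => j _; rewrite mxE.
Qed.

Lemma iter_linear_ex X (u : {linear X -> X}) m :
  exists v : {linear X -> X}, forall x, v x = iter m u x.
Proof.
elim: m => [|m [v vE]]; first by exists idfun.
by exists (u \o v) => x; rewrite /= vE.
Qed.

(* Cayley-Hamilton: [u] annihilates ['X^m * q] with [q.[0] != 0], and [c] is
   [(q.[0] - q) / (q.[0] * 'X)] evaluated at [u]. *)
Lemma iter_stabilizes X (u : {linear X -> X}) : finitely_generated X ->
  exists (m : nat) (c : {linear X -> X}),
    (forall x, c (u x) = u (c x)) /\
    forall x, iter m u x = c (iter m.+1 u x).
Proof.
move=> /finitely_generated_over_field[[|N] [b bP]].
  (* Without generators [X] is zero; otherwise the computation takes place in the nonzero ring
     ['M[k]_N.+1]. *)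
  exists 0, idfun; split=> // x /=; have [r ->] := bP x.
  by rewrite big_ord0 linear0.
pose phi (r : 'rV[k]_N.+1) := \sum_j (r 0 j)%:A *: b j.
have phi_surj x : exists r, x = phi r by apply: bP.
have phiD r s : phi (r + s) = phi r + phi s.
  rewrite -big_split; apply: eq_bigr => j _ /=.
  by rewrite mxE scalerDl scalerDl.
have phiZ a r : phi (a *: r) = a%:A *: phi r.
  rewrite scaler_sumr; apply: eq_bigr => j _ /=.
  by rewrite mxE [RHS]scalerA mulr_algl scalerA.
have phi0 : phi 0 = 0 by rewrite -(scale0r 0) phiZ scale0r scale0r.
have ub i : exists r, u (b i) == phi r.
  by have [r ur] := phi_surj (u (b i)); exists r; apply/eqP.
(* The [b i] may be linearly dependent, so [A] is only one lift of [u] along the surjection [phi],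
   acting on row vectors from the right. *)
pose A : 'M[k]_N.+1 := \matrix_i xchoose (ub i).
have uphi r : u (phi r) = phi (r *m A).
  have phi_sum (F : 'I_N.+1 -> 'rV[k]_N.+1) : phi (\sum_i F i) = \sum_i phi (F i).
    exact: (big_morph phi phiD phi0).
  rewrite mulmx_sum_row phi_sum linear_sum; apply: eq_bigr => i _.
  by rewrite linearZ /= phiZ rowK -(eqP (xchooseP (ub i))).
have iterphi i r : iter i u (phi r) = phi (r *m A ^+ i).
  elim: i => [|i IHi]; first by rewrite expr0 mulmx1.
  by rewrite iterS IHi uphi -mulmxA exprSr.
have ev (p : {poly k}) : exists c : {linear X -> X},
    forall r, c (phi r) = phi (r *m horner_mx A p).
  elim/poly_ind: p => [|p a [c cE]].
    by exists \0 => r; rewrite rmorph0 mulmx0 phi0.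
  (* Scalars of [k] are central in [H], so acting by them is [H]-linear. *)
  have [d dE] : exists d : {linear X -> X}, forall x, d x = a%:A *: x.
    apply: linear_ex => h x y; rewrite scalerDr !scalerA.
    by rewrite mulr_algl mulr_algr.
  exists ((c \o u) \+ d) => r.
  rewrite /= uphi cE dE rmorphD rmorphM /= horner_mx_X horner_mx_C.
  rewrite mulmxDr phiD mul_mx_scalar phiZ -mulmxA.
  by congr (phi (_ *m _) + _); apply: (comm_mx_horner p (erefl : comm_mx A A)).
have p_neq0 : char_poly A != 0 by rewrite monic_neq0 ?char_poly_monic.
have [m [q q0 pE]] := multiplicity_XsubC (char_poly A) 0.
rewrite p_neq0 /= subr0 in q0 pE.
have := Cayley_Hamilton A; rewrite pE rmorphM rmorphXn /= horner_mx_X => qA.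
pose s := - (q.[0])^-1 *: (q %/ 'X).
have sA : A ^+ m = horner_mx A s * A ^+ m.+1.
  have qE : q = (q %/ 'X) * 'X + (q.[0])%:P.
    by have := divp_eq q ('X - 0%:P); rewrite modp_XsubC subr0.
  move: qA; rewrite {1}qE rmorphD rmorphM /= horner_mx_X horner_mx_C.
  rewrite mulrDl -mulrA -exprS => /eqP; rewrite addr_eq0 => /eqP qA'.
  rewrite /s linearZ /= -scalerAl qA' scaleNr scalerN opprK.
  by rewrite -[_ %:M * _]/(_ %:M *m _) mul_scalar_mx scalerA mulVf ?scale1r.
have [c cE] := ev s; exists m, c; split=> x; have [r ->] := phi_surj x.
  rewrite !uphi !cE uphi -!mulmxA; congr (phi (_ *m _)).
  exact: (comm_mx_horner s (erefl : comm_mx A A)).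
rewrite /= !iterphi uphi cE -!mulmxA; congr (phi (_ *m _)).
rewrite {1}sA mulmxA -[A ^+ m *m A]/(A ^+ m * A) -exprSr.
exact: (comm_horner_mx s (commrX _ (erefl : GRing.comm A A))).
Qed.

(** On the image of [u^m] the map [c] inverts [u], so [c^m u^m] is idempotent, hence 0 or 1. In the
    first case [u^m = 0], in the second [u] is injective. *)
Lemma fitting X (u : {linear X -> X}) :
  finitely_generated X -> indecomposable X ->
  injective u \/ exists m, forall x, iter m u x = 0.
Proof.
move=> /iter_stabilizes fgX indX; have [m [c [cu um]]] := fgX u.
have cui i x : c (iter i u x) = iter i u (c x).
  by elim: i => //= i IHi; rewrite cu IHi.
have ciu i j x : iter j c (iter i u x) = iter i u (iter j c x).
  by elim: j => //= j ->; rewrite cui.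
have umi i x : iter (i + m) u x = c (iter (i + m).+1 u x).
  by rewrite -addnS !iterD cui -um.
have umj j x : iter m u x = iter j c (iter j u (iter m u x)).
  rewrite -iterD; elim: j => // j {1}->.
  by rewrite umi -iterSr.
have [cm cmE] := iter_linear_ex c m; have [v vE] := iter_linear_ex u m.
have [x|e0|e1] := @indecomposable_idempotent _ _ (cm \o v) indX.
- by rewrite /= !cmE !vE -ciu -umj.
- right; exists m => x; have := e0 x; rewrite /= cmE vE => cu0.
  by rewrite (umj m) ciu cu0 -vE linear0.
(* Rewriting with [um] exposes one more factor [u], which also covers [m = 0]. *)
left=> x y uxy; rewrite -(e1 x) -(e1 y) /= !vE !um !iterSr uxy //.
Qed.

(** The witness is the geometric series [1 + u + ... + u^(m-1)]; its product with [1 - u] telescopes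
    to [1 - u^m]. *)
Lemma sub_nilpotent_inverse X (u : {linear X -> X}) m :
  (forall x, iter m u x = 0) ->
  exists w : {linear X -> X}, forall x, w (x - u x) = x.
Proof.
move=> um0; suff [w wP] : exists w : {linear X -> X},
    forall x, w (x - u x) = x - iter m u x.
  by exists w => x; rewrite wP um0 subr0.
elim: m {um0} => [|m [w wP]]; first by exists \0 => x; rewrite subrr.
exists (idfun \+ (w \o u)) => x; rewrite /= linearB wP -iterSr.
by rewrite addrA subrK.
Qed.

(** * The Happel-Ringel lemma *)

Hypothesis hH : hereditary H.

(* With [pi : X -> I] the corestriction of [f] to its image and [q : P -> Y] an
   epimorphism from a projective, the preimage [K] of [I] in [P] is projective, so
   [q : K -> I] lifts to [s : K -> X].  As [Ext^1(Y, X) = 0], [s] extends from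
   [ker q] to [t : P -> X], and [s - t] descends to [a : I -> X].  If [a pi] is
   not injective, then [1 - a pi] is invertible and its inverse corrects [t] to
   an extension [t'] of [s] to [P]; then [q - f t'] induces an idempotent of [Y]
   with kernel [I]. *)
Lemma happel_ringel X Y (f : {linear X -> Y}) :
  finitely_generated X -> indecomposable X ->
  finitely_generated Y -> indecomposable Y -> ext1_zero Y X ->
  [\/ forall x, f x = 0, injective f | surj f].
Proof.
move=> fgX indX /finitely_generated_cover[P Pproj [q q_surj]] indY extYX.
have [I [i [i_inj iP]]] := submodule_ex (im_submod f).
have [x|pi piE] := @factor_inj _ _ _ _ i f i_inj; first by apply/iP; exists x.
have pi_surj : surj pi.
  move=> y; have [|x fx] := (iP (i y)).2; first by exists y.
  by exists x; apply: i_inj; rewrite piE.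
have [K [d [d_inj dP]]] := submodule_ex (preim_submod q (im_submod f)).
have [x|q' q'E] := @factor_inj _ _ _ _ i (q \o d) i_inj.
  by apply/iP/dP; exists x.
have q'_surj : surj q'.
  move=> y; have [x xy] := q_surj (i y).
  have [|z zx] := (dP x).1; first by rewrite xy; apply/iP; exists y.
  by exists z; apply: i_inj; rewrite q'E /= zx.
have [s sE] := hH d_inj Pproj q' pi_surj.
have [K0 [c [c_inj cP]]] := submodule_ex (ker_submod q').
have dc_inj : injective (d \o c) by apply: inj_comp.
have dcP x : q x = 0 <-> exists y, (d \o c) y = x.
  split=> [qx|[y <-]].
    have [|y yx] := (dP x).1; first by exists 0; rewrite linear0.
    have [|z zy] := (cP y).1; last by exists z; rewrite /= zy.
    by apply: i_inj; rewrite q'E /= yx qx linear0.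
  by rewrite -[q _]q'E (proj2 (cP _)) ?linear0 //; exists y.
have [t tE] := ext1_zero_extend (Extension dc_inj q_surj dcP) (s \o c) extYX.
rewrite /= in t tE.
have [_ /cP[y <-]|a aE] := @factor_surj _ _ _ _ q' (s \- (t \o d)) q'_surj.
  by rewrite /= tE subrr.
have [upi_inj|[m um0]] := fitting (a \o pi) fgX indX.
  apply: Or32 => x y fxy; apply: upi_inj => /=; congr (a _).
  by apply: i_inj; rewrite !piE.
have [w wE] := sub_nilpotent_inverse um0.
pose t' := w \o t.
(* On [K], [t d = s - a q' = (1 - a pi) s], and [w] is a left inverse of [1 - a pi]. *)
have t'E z : t' (d z) = s z.
  by rewrite -[s z]wE /= sE aE /= opprB addrC subrK.
have ft' z : f (t' (d z)) = q (d z) by rewrite t'E -piE sE q'E.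
have [x /dcP[y <-]|g gE] := @factor_surj _ _ _ _ q (q \- (f \o t')) q_surj.
  by rewrite /= -[f _]/(f (t' (d (c y)))) ft' subrr.
have gf x : g (f x) = 0.
  have [y yx] := q_surj (f x).
  have [|z zy] := (dP y).1; first by exists x.
  by rewrite -yx gE -zy /= -[f _]/(f (t' (d z))) ft' subrr.
(* If [g = 0] then [q = f t'], so [f] is onto; if [g = 1] then [f = g f = 0]. *)
have [y|g0|g1] := indecomposable_idempotent (e := g) indY.
- by have [x <-] := q_surj y; rewrite [in LHS]gE /= linearB /= gf subr0.
- apply: Or33 => y; have [x <-] := q_surj y; exists (t' x).
  by apply/esym/eqP; rewrite -subr_eq0; apply/eqP; rewrite -[LHS]gE g0.
by apply: Or31 => x; rewrite -[f x]g1.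
Qed.

End Fitting.

(** * Combinatorics of paths with three kinds of arrows *)

Section NormalForm.
Variables (V : Type) (h : V -> nat) (M P X : V -> V -> Prop).
Hypothesis M_lt : forall u v, M u v -> (h u < h v)%N.
Hypothesis P_lt : forall u v, P u v -> (h u < h v)%N.
Hypothesis X_gt : forall u v, X u v -> (h v < h u)%N.
Hypothesis MM : forall u v w, M u v -> M v w -> M u w.
Hypothesis PP : forall u v w, P u v -> P v w -> P u w.
Hypothesis PM : forall u v w, P u v -> M v w -> M u w \/ P u w.
Hypothesis PX : forall u v w, P u v -> X v w -> X u w.
Hypothesis XM : forall u v w, X u v -> M v w -> X u w.

Local Notation Xplus := (clos_trans V X).

Lemma P_Xplus u v w : P u v -> Xplus v w -> Xplus u w.
Proof.
move=> uv vw; elim: vw u uv => {v w} [v w vw u uv|v x w _ IHv xw _ u uv].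
  exact/t_step/(PX uv).
by apply: t_trans xw; apply: IHv.
Qed.

Lemma Xplus_M u v w : Xplus u v -> M v w -> Xplus u w.
Proof.
move=> uv; elim: uv w => {u v} [u v uv w vw|u x v ux _ _ IHv w vw].
  exact/t_step/(XM uv).
by apply: t_trans ux _; apply: IHv.
Qed.

Lemma Xplus_irrefl v : ~ Xplus v v.
Proof.
suff gt u w : Xplus u w -> (h w < h u)%N by move/gt; rewrite ltnn.
by elim=> {u w} [u w /X_gt|u x w _ xu _ wx] //; apply: ltn_trans xu.
Qed.

Let XP u v := exists2 b, Xplus u b & b = v \/ P b v.

(** The nonempty words of the form [M? X* P?]: the first two cases contain an [X], the last two do
    not. *)
Definition normal_path u v :=
  [\/ XP u v, exists2 a, M u a & XP a v, M u v \/ P u v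
    | exists2 a, M u a & P a v].

(** A new first letter [M] merges with a following [M]; a [P] merges with a following [M] or [P] or
    is absorbed by an [X]; an [X] absorbs a following [M]. *)
Lemma normal_path_cons u w v :
  [\/ M u w, P u w | X u w] -> normal_path w v -> normal_path u v.
Proof.
have X_XP u1 w1 v1 : X u1 w1 -> XP w1 v1 -> XP u1 v1.
  by move=> uw [b wb bv]; exists b => //; apply: t_trans wb; apply: t_step.
have P_XP u1 w1 v1 : P u1 w1 -> XP w1 v1 -> XP u1 v1.
  by move=> uw [b wb bv]; exists b => //; apply: P_Xplus wb.
case=> uw [wv|[a wa av]|[wv|wv]|[a wa av]].
- by apply: Or42; exists w.
- by apply: Or42; exists a => //; apply: MM wa.
- by apply: Or43; left; apply: MM wv.
- by apply: Or44; exists w.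
- by apply: Or44; exists a => //; apply: MM wa.
- exact/Or41/(P_XP _ _ _ uw).
- have [ua|ua] := PM uw wa; first by apply: Or42; exists a.
  exact/Or41/(P_XP _ _ _ ua).
- exact/Or43/(PM uw).
- by apply: Or43; right; apply: PP wv.
- have [ua|ua] := PM uw wa; first by apply: Or44; exists a.
  by apply: Or43; right; apply: PP av.
- exact/Or41/(X_XP _ _ _ uw).
- exact/Or41/(X_XP _ _ _ (XM uw wa)).
- by apply: Or41; exists v; [apply/t_step/(XM uw) | left].
- by apply: Or41; exists w; [apply: t_step | right].
by apply: Or41; exists a; [apply/t_step/(XM uw) | right].
Qed.

Lemma normal_path_irrefl v : ~ normal_path v v.
Proof.
case=> [[b vb [bv|bv]]|[a va [b ab [bv|bv]]]|[/M_lt|/P_lt]|[a /M_lt va /P_lt av]].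
- by rewrite bv in vb; apply: Xplus_irrefl vb.
- exact: Xplus_irrefl (P_Xplus bv vb).
- by rewrite bv in ab; apply: Xplus_irrefl (Xplus_M ab va).
(* Rotation puts [P b v] before [M v a]; their composite is absorbed at the end of the [X] block if
   it is an [M], at its start if it is a [P]. *)
- have [ba|ba] := PM bv va; first exact: Xplus_irrefl (Xplus_M ab ba).
  exact: Xplus_irrefl (P_Xplus ba ab).
- by rewrite ltnn.
- by rewrite ltnn.
by have := ltn_trans va av; rewrite ltnn.
Qed.

Lemma normal_form_acyclic : acyclic (fun u v => [\/ M u v, P u v | X u v]).
Proof.
suff np u v : clos_trans V (fun u v => [\/ M u v, P u v | X u v]) u v ->
    normal_path u v by move=> v /np/normal_path_irrefl.
move=> uv; elim: (clos_trans_t1n _ _ _ _ uv) => {u v uv} [u v|u w v uw _].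
  case=> uv; first by apply: Or43; left.
    by apply: Or43; right.
  by apply: Or41; exists v; [apply: t_step | left].
by apply: normal_path_cons.
Qed.

End NormalForm.

Theorem theorem1p4 (k : fieldType) (H : falgType k) (hH : hereditary H)
    (n : nat) (hn : simple_classes H n)
    (E : 'I_n -> lmodType H) (hE : exceptional_sequence E) :
  acyclic (hom_ext_arrow E).
Proof.
have [excE orthE] := hE.
have fgE i : finitely_generated (E i) by have [] := excE i.
have indE i : indecomposable (E i) by have [] := excE i.
(* With the inequality recorded, the index serves as the height in [normal_form_acyclic]. *)
pose M (u v : 'I_n) := (u < v)%N /\ exists f : {linear E u -> E v}, injective f.
pose P (u v : 'I_n) := (u < v)%N /\ exists f : {linear E u -> E v}, surj f.
pose X (u v : 'I_n) := (v < u)%N /\ ~ ext1_zero (E v) (E u).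
(* For [u < v] this Ext^1 vanishes by orthogonality and for [u = v] by exceptionality, so its
   nonvanishing forces [v < u]. *)
have X_of u v : ~ ext1_zero (E v) (E u) -> X u v.
  move=> ext; split=> //; case: (ltngtP v u) => // [uv|/val_inj e].
    by case: ext; apply: (orthE u v uv).2.
  by case: ext; rewrite e; have [] := excE u.
have MP_of u v (f : {linear E u -> E v}) :
    (u < v)%N -> ~ (forall x, f x = 0) -> M u v \/ P u v.
  move=> uv f0; have extvu := (orthE u v uv).2.
  have [//|f_inj|f_surj] :=
    happel_ringel hH f (fgE u) (indE u) (fgE v) (indE v) extvu.
    by left; split=> //; exists f.
  by right; split=> //; exists f.
have arrowP u v : hom_ext_arrow E u v -> [\/ M u v, P u v | X u v].
  move=> [uv [hom|ext]]; last exact/Or33/X_of.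
  have lt_uv : (u < v)%N.
    case: (ltngtP u v) => // [vu|/val_inj //].
    by case: hom; apply: (orthE v u vu).1.
  have [f f0] : exists f : {linear E u -> E v}, ~ (forall x, f x = 0).
    exact: not_all_ex_not hom.
  by have [|] := MP_of u v f lt_uv f0; [apply: Or31 | apply: Or32].
have arrowP_trans u v : clos_trans _ (hom_ext_arrow E) u v ->
    clos_trans _ (fun a b => [\/ M a b, P a b | X a b]) u v.
  elim=> {u v} [u v /arrowP|u w v _ uw _]; [exact: t_step | exact: t_trans].
move=> v /arrowP_trans; move: v.
apply: (@normal_form_acyclic _ (@nat_of_ord n)).
- by move=> ? ? [].
- by move=> ? ? [].
- by move=> ? ? [].
- move=> a b c [ab [f f_inj]] [bc [g g_inj]]; split; first exact: ltn_trans bc.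
  by exists (g \o f); apply: inj_comp.
- move=> a b c [ab [f f_surj]] [bc [g g_surj]]; split; first exact: ltn_trans bc.
  exists (g \o f) => z; have [y <-] := g_surj z; have [x <-] := f_surj y.
  by exists x.
- move=> a b c [ab [f f_surj]] [bc [g g_inj]].
  apply: (MP_of _ _ (g \o f)) => [|gf0]; first exact: ltn_trans bc.
  (* If the epi followed by the mono were zero, then [E b] would be zero, against
     indecomposability. *)
  case: (indE b) => nz _; apply: nz => y; have [x <-] := f_surj y.
  by apply: g_inj; rewrite linear0; apply: gf0.
- move=> a b c [_ [f f_surj]] [_ ext]; apply: X_of => ext'; apply: ext.
  exact: (ext1_zero_epi hH (fgE c) f_surj ext').
- move=> a b c [_ ext] [_ [g g_inj]]; apply: X_of => ext'; apply: ext.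
  exact: (ext1_zero_mono hH (fgE c) g_inj ext').
Qed.
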